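(* Let $\gamma,\gamma',\rho,\varepsilon\in(0,1]$ and $m,n\in\mathbb{Z}_{>0}$. Let $\boldsymbol{u}\in\mathbb{R}_{>0}^m$, $\boldsymbol{v}\in\mathbb{R}_{>0}^n$ with $\|\boldsymbol{u}\|_1=\|\boldsymbol{v}\|_1=1$, and let $B\in\mathbb{R}_{\ge0}^{m\times n}$ be $(\gamma,\gamma',\rho)$-dense with respect to $(\boldsymbol{u},\boldsymbol{v})$. If $\gamma+\gamma'>1$, then with input $(B,(\boldsymbol{u},\boldsymbol{v}))$ the SK algorithm outputs a matrix $A$ satisfying $\|\boldsymbol{r}(A)-\boldsymbol{u}\|_1+\|\boldsymbol{c}(A)-\boldsymbol{v}\|_1\le\varepsilon$ within $$O\Bigl(\rho^{-14}(\gamma+\gamma'-1)^{-6}\bigl(\log n-\log\varepsilon-\log\rho-\log(\gamma+\gamma'-1)\bigr)\Bigr)$$ iterations.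
   Context: $r_i(A)$, $c_j(A)$ are row/column sums; $\boldsymbol{r}(A),\boldsymbol{c}(A)$ the corresponding vectors. SK algorithm on input $(A,(\boldsymbol{u},\boldsymbol{v}))$ (nonzero nonnegative $A$, positive $\boldsymbol{u},\boldsymbol{v}$ with equal $\ell_1$ norms): $A^{(0)}_{ij}=u_iA_{ij}/r_i(A)$; odd $k$: $A^{(k)}_{ij}=v_jA^{(k-1)}_{ij}/c_j(A^{(k-1)})$; even $k\ge2$: $A^{(k)}_{ij}=u_iA^{(k-1)}_{ij}/r_i(A^{(k-1)})$. ''Outputs within $T$ iterations'' means some $A^{(k)}$, $k\le T$, has the property; $O$ hides an absolute constant. Density: for positive $\boldsymbol{u}\in\mathbb{R}^m,\boldsymbol{v}\in\mathbb{R}^n$ with $\|\boldsymbol{u}\|_1=\|\boldsymbol{v}\|_1$ and nonzero $A\in\mathbb{R}_{\ge0}^{m\times n}$ with $t=\max_{ij}A_{ij}$, $A$ is $(\gamma,\gamma',\rho)$-dense with respect to $(\boldsymbol{u},\boldsymbol{v})$ if $\gamma=\min_{i\in[m]}\sum_{k\in[n]}v_k\mathbf{1}[A_{ik}>\rho t]/\|\boldsymbol{v}\|_1$ and $\gamma'=\min_{j\in[n]}\sum_{k\in[m]}u_k\mathbf{1}[A_{kj}>\rho t]/\|\boldsymbol{u}\|_1$. *)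

(* Defs.v *)
From mathcomp Require Import all_boot all_order all_algebra.
From mathcomp Require Import reals.

Set Implicit Arguments.
Unset Strict Implicit.
Unset Printing Implicit Defensive.

Import Order.TTheory GRing.Theory Num.Theory.
Local Open Scope ring_scope.

Definition row_sums (R : realType) (m n : nat) (A : 'M[R]_(m, n)) : 'rV[R]_m :=
  \row_i \sum_j A i j.

Definition col_sums (R : realType) (m n : nat) (A : 'M[R]_(m, n)) : 'rV[R]_n :=
  \row_j \sum_i A i j.

Definition l1norm (R : realType) (n : nat) (x : 'rV[R]_n) : R :=
  \sum_i `|x 0 i|.

Definition scale_rows (R : realType) (m n : nat) (u : 'rV[R]_m)
    (A : 'M[R]_(m, n)) : 'M[R]_(m, n) :=
  \matrix_(i, j) (u 0 i * A i j / row_sums A 0 i).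

Definition scale_cols (R : realType) (m n : nat) (v : 'rV[R]_n)
    (A : 'M[R]_(m, n)) : 'M[R]_(m, n) :=
  \matrix_(i, j) (v 0 j * A i j / col_sums A 0 j).

(* The k-th Sinkhorn-Knopp iterate A^(k); A^(0) is already row-scaled. *)
Fixpoint SK (R : realType) (m n : nat) (A : 'M[R]_(m, n))
    (u : 'rV[R]_m) (v : 'rV[R]_n) (k : nat) : 'M[R]_(m, n) :=
  match k with
  | 0%N => scale_rows u A
  | k'.+1 => if odd k'.+1 then scale_cols v (SK A u v k')
             else scale_rows u (SK A u v k')
  end.

(* Used for entrywise nonnegative A, for which the default value 0 of the
   iterated maximum is harmless. *)
Definition max_entry (R : realType) (m n : nat) (A : 'M[R]_(m, n)) : R :=
  \big[Num.max/0]_(i < m) \big[Num.max/0]_(j < n) A i j.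

Definition is_min (R : realType) (n : nat) (F : 'I_n -> R) (x : R) : Prop :=
  (exists i, F i = x) /\ (forall i, x <= F i).

Definition sk_dense (R : realType) (m n : nat) (gamma gamma' rho : R)
    (u : 'rV[R]_m) (v : 'rV[R]_n) (A : 'M[R]_(m, n)) : Prop :=
  is_min (fun i : 'I_m =>
    (\sum_(k < n | rho * max_entry A < A i k) v 0 k) / l1norm v) gamma /\
  is_min (fun j : 'I_n =>
    (\sum_(k < m | rho * max_entry A < A k j) u 0 k) / l1norm u) gamma'.

(* Main.v *)
Require Import Defs.
From mathcomp Require Import all_boot all_order all_algebra.
From mathcomp Require Import reals sequences exp.
From mathcomp Require Import ring lra.

(* Write d = gamma + gamma' - 1, normalize max B = 1, and write an iterate as
   A_ij = u_i x_i B_ij y_j v_j.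

   While the marginal error E exceeds d/2, every half-step increases the
   potential sum_i u_i ln x_i + sum_j v_j ln y_j by a relative entropy, hence by
   at least d^2/16 (Pinsker).  The potential starts above -ln n, because the row
   sums of B are at most n, and it is at most ln(4/(d rho)) + 1 whenever A has
   mass 1.  So E <= d/2 after O(d^-2 (ln n - ln d - ln rho)) half-steps.

   Once E <= d/2, density forces (sum_i u_i x_i)(sum_j v_j y_j) <= 2/(rho^2 d),
   so that after normalizing each row (resp. column) to a probability, a dense
   entry is at least (rho^3 d/2) v_j (resp. u_i).  The new error vector is the
   image of the old one under this Markov kernel.  If gamma >= gamma', any two
   rows share dense columns of v-mass at least 2 gamma - 1 >= d, so Dobrushin's
   coefficient gives an l1 contraction by 1 - rho^3 d^2/2 at each row scaling; if
   gamma < gamma' the same happens at each column scaling.  The other half-steps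
   do not increase E. *)

Set Implicit Arguments.
Unset Strict Implicit.
Unset Printing Implicit Defensive.

Import Order.TTheory GRing.Theory Num.Theory.
Local Open Scope ring_scope.

(** * Relative entropy and quantiles *)

Lemma ler_sum_subpred (R : realType) (I : finType) (w : I -> R) (P Q : pred I) :
  (forall i, 0 <= w i) -> (forall i, P i -> Q i) ->
  \sum_(i | P i) w i <= \sum_(i | Q i) w i.
Proof.
move=> w0 PQ; rewrite [leLHS]big_mkcond [leRHS]big_mkcond; apply: ler_sum => i _.
by case: ifP => [/PQ ->|_] //; case: ifP.
Qed.

Lemma ln_le_subr1 (R : realType) (x : R) : 0 < x -> ln x <= x - 1.
Proof. by move=> x0; rewrite -{1}(subrKC 1 x); apply: le_ln1Dx; lra. Qed.

(** With [s] the square root of [r / u], the bound [ln s <= s - 1] makes the right side at least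
    [u * (1 - s) ^+ 2], the squared Hellinger term. Since [|u - r| = u * |1 - s| * (1 + s)],
    completing a square in [lam] gives the rest. *)
Lemma ln_gap (R : realType) (u r lam : R) : 0 < u -> 0 < r ->
  lam * `|u - r| - lam ^+ 2 / 2 * (u + r) <= u * ln (u / r) - u + r.
Proof.
move=> u0 r0; pose s := Num.sqrt (r / u).
have s0 : 0 < s by rewrite sqrtr_gt0 divr_gt0.
have s2 : s ^+ 2 = r / u by rewrite sqr_sqrtr // ltW // divr_gt0.
have rE : r = u * s ^+ 2 by rewrite s2 mulrCA divff ?mulr1 // gt_eqF.
have -> : ln (u / r) = - (ln s *+ 2).
  by rewrite -lnXn // s2 -lnV ?posrE ?divr_gt0 // invf_div.
have lns := ln_le_subr1 s0.
have -> : `|u - r| = u * (`|1 - s| * (1 + s)).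
  rewrite rE -[X in X - _]mulr1 -mulrBr normrM (gtr0_norm u0).
  have -> : 1 - s ^+ 2 = (1 - s) * (1 + s) by ring.
  by rewrite normrM (gtr0_norm (x := 1 + s)) //; lra.
have a2 : `|1 - s| ^+ 2 = (1 - s) ^+ 2 by rewrite real_normK ?num_real.
rewrite rE; set a := `|1 - s| in a2 *.
have h1 : 0 <= (a - lam * (1 + s) / 2) ^+ 2 by apply: sqr_ge0.
have h2 : 0 <= lam ^+ 2 * (1 - s) ^+ 2 by rewrite mulr_ge0 ?sqr_ge0.
have h3 : lam * (a * (1 + s)) - lam ^+ 2 / 2 * (1 + s ^+ 2) <= (1 - s) ^+ 2 by lra.
have h4 : (1 - s) ^+ 2 <= - (ln s *+ 2) - 1 + s ^+ 2 by rewrite mulr2n; lra.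
have := ler_wpM2l (ltW u0) (le_trans h3 h4); lra.
Qed.

(* A linear form of Pinsker's inequality; optimizing over [lam] gives a
   quadratic lower bound on the relative entropy. *)
Lemma relative_entropy_ge (R : realType) (I : finType) (u r : I -> R) (lam : R) :
  (forall i, 0 < u i) -> (forall i, 0 < r i) ->
  \sum_i u i = 1 -> \sum_i r i = 1 ->
  lam * (\sum_i `|u i - r i|) - lam ^+ 2 <= \sum_i u i * ln (u i / r i).
Proof.
move=> u0 r0 u1 r1.
have : \sum_i (lam * `|u i - r i| - lam ^+ 2 / 2 * (u i + r i)) <=
       \sum_i (u i * ln (u i / r i) - u i + r i).
  by apply: ler_sum => i _; apply: ln_gap.
rewrite !(big_split, sumrN) /= -!mulr_sumr big_split /= u1 r1; lra.
Qed.

(** Take for [c] the largest value of [f] whose upper level set still has weight at least [b]. The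
    strict upper set is empty or is the upper level set of the next larger value, so by maximality
    it weighs at most [b]. *)
Lemma quantile_exists (R : realType) (I : finType) (w f : I -> R) (b : R) :
  (forall i, 0 <= w i) -> \sum_i w i = 1 -> 0 < b <= 1 ->
  exists c, b <= \sum_(i | c <= f i) w i /\ \sum_(i | c < f i) w i <= b.
Proof.
move=> w0 w1 /andP[b0 b1].
have [i0 _] : exists i0 : I, true.
  case: (pickP (fun _ : I => true)) => [i _|no]; first by exists i.
  by move: w1; rewrite big_pred0 // => /esym/eqP; rewrite oner_eq0.
pose P i := b <= \sum_(k | f i <= f k) w k.
pose m := [arg min_(i < i0 | predT i) f i]%O.
have Pm : P m.
  rewrite /m; case: arg_minP => // i _ h; rewrite /P (eq_bigl predT) ?w1 // => k.
  by rewrite h.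
pose M := [arg max_(i > m | P i) f i]%O.
exists (f M); rewrite /M; case: arg_maxP => // i Pi imax; split => //.
case: (pickP (fun k => f i < f k)) => [k1 k1P|no]; last first.
  by rewrite big_pred0 // ltW.
rewrite leNgt; apply/negP => H.
pose k := [arg min_(k < k1 | f i < f k) f k]%O.
have [ik kmin] : f i < f k /\ forall j, f i < f j -> f k <= f j.
  by rewrite /k; case: arg_minP => // j ij h; split.
have : P k.
  exact: le_trans (ltW H) (ler_sum_subpred w0 kmin).
by move/imax => /=; rewrite leNgt ik.
Qed.

Lemma sum_setI_ge (R : realType) (I : finType) (w : I -> R) (P Q : pred I) (p q : R) :
  (forall i, 0 <= w i) -> \sum_i w i = 1 ->
  p <= \sum_(i | P i) w i -> q <= \sum_(i | Q i) w i ->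
  p + q - 1 <= \sum_(i | P i && Q i) w i.
Proof.
move=> w0 w1 hp hq.
suff : \sum_(i | P i) w i + \sum_(i | Q i) w i <= 1 + \sum_(i | P i && Q i) w i by lra.
rewrite -w1 [X in X + _ <= _]big_mkcond [X in _ + X <= _]big_mkcond.
rewrite [X in _ <= _ + X]big_mkcond -!big_split /=; apply: ler_sum => i _.
by case: (P i) (Q i) => [] [] /=; rewrite ?addr0 ?add0r.
Qed.

(** * Dense kernels *)

(** Density with the maximum entry scaled to at most 1 and with [g], [g'] as lower bounds only. The
    form is symmetric under transposition, so each fact about row scalings also yields the one about
    column scalings. *)
Record dense_kernel (R : realType) (I J : finType) (u : I -> R) (v : J -> R)
    (B : I -> J -> R) (D : I -> J -> bool) (g g' rho : R) : Prop := DenseKernel {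
  dk_u_gt0 : forall i, 0 < u i;
  dk_v_gt0 : forall j, 0 < v j;
  dk_u_sum : \sum_i u i = 1;
  dk_v_sum : \sum_j v j = 1;
  dk_ge0 : forall i j, 0 <= B i j;
  dk_le1 : forall i j, B i j <= 1;
  dk_dense : forall i j, D i j -> rho <= B i j;
  dk_row : forall i, g <= \sum_(j | D i j) v j;
  dk_col : forall j, g' <= \sum_(i | D i j) u i;
  dk_rho : 0 < rho <= 1;
  dk_g : 0 < g <= 1;
  dk_g' : 0 < g' <= 1;
  dk_gap : 1 < g + g' }.

Lemma dense_kernel_tr (R : realType) (I J : finType) (u : I -> R) (v : J -> R)
    (B : I -> J -> R) (D : I -> J -> bool) (g g' rho : R) :
  dense_kernel u v B D g g' rho ->
  dense_kernel v u (fun j i => B i j) (fun j i => D i j) g' g rho.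
Proof. by case=> ? ? ? ? ? ? BD *; split => //; [move=> j i; apply: BD | rewrite addrC]. Qed.

Lemma dense_row_pos_part (R : realType) (J : finType) (v g : J -> R) (P : pred J)
    (p q a x : R) :
  (forall j, 0 <= v j) -> \sum_j v j = 1 ->
  p <= \sum_(j | P j) v j -> q <= \sum_(j | - a <= g j) v j ->
  (p + q - 1) * Num.max (x - a) 0 <= \sum_(j | P j) v j * Num.max (x + g j) 0.
Proof.
move=> v0 v1 hp hq; have h := sum_setI_ge v0 v1 hp hq.
apply: (le_trans (ler_wpM2r _ h)); first by rewrite le_max lexx orbT.
rewrite mulr_suml [leLHS]big_mkcond [leRHS]big_mkcond; apply: ler_sum => j _.
case: (P j) => //=; case: ifP => [ag|_]; last by rewrite mulr_ge0 // le_max lexx orbT.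
by apply: ler_wpM2l => //; rewrite ge_max !le_max lexx orbT andbT lerD2l ag.
Qed.

(* Linear programming duality in disguise: the inequality says that the
   marginals [u], [v] admit a coupling supported on [D] with density at most
   [4 / (g + g' - 1)] with respect to the product [u x v]. *)
Lemma dense_dual_bound (R : realType) (I J : finType) (u : I -> R) (v : J -> R)
    (B : I -> J -> R) (D : I -> J -> bool) (g g' rho : R) (x : I -> R) (y : J -> R) :
  dense_kernel u v B D g g' rho ->
  (g + g' - 1) / 4 * (\sum_i u i * x i + \sum_j v j * y j) <=
  \sum_i \sum_(j | D i j) u i * v j * Num.max (x i + y j) 0.
Proof.
case=> u0 v0 u1 v1 _ _ _ row col _ /andP[g0 g1] /andP[g'0 g'1] gap.
have u0' i := ltW (u0 i); have v0' j := ltW (v0 j).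
(* This level splits the gap evenly: [g + al - 1] and [g' + (1 - al) - 1] both equal
   [(g + g' - 1) / 2]. *)
pose al := (1 - g + g') / 2.
have al01 : 0 < al <= 1 by rewrite /al; lra.
have be01 : 0 < 1 - al <= 1 by rewrite /al; lra.
have [c1 [c1l c1r]] := quantile_exists x u0' u1 be01.
have [d [dl dr]] := quantile_exists y v0' v1 al01.
(* Rows are compared with the shift [a], columns with [c1]. If [c1 < - d] the two shifts differ, and
   the strict quantile bounds produce corrections [(a - c1) * (1 - al)] in [sumx] and its opposite
   in [sumy], which cancel in [sumxy]. *)
pose a := Num.max c1 (- d).
have ca : c1 <= a by rewrite le_max lexx.
have da : - a <= d by rewrite lerNl le_max lexx orbT.
have al_a : al <= \sum_(j | - a <= y j) v j.
  by apply: (le_trans dl); apply: ler_sum_subpred => // j; apply: le_trans.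
pose X := \sum_i u i * Num.max (x i - a) 0.
pose Y := \sum_j v j * Num.max (y j + c1) 0.
have pos_ge0 (z : R) : 0 <= Num.max z 0 by rewrite le_max lexx orbT.
have sumx : \sum_i u i * x i <= X + c1 + (a - c1) * (1 - al).
  apply: (@le_trans _ _ (X + c1 + (a - c1) * \sum_(i | c1 < x i) u i)); last first.
    by rewrite lerD2l; apply: ler_wpM2l => //; rewrite subr_ge0.
  rewrite -[X in _ + X + _]mulr1 -u1 (big_mkcond (fun i => c1 < x i)) !mulr_sumr.
  rewrite -!big_split /=; apply: ler_sum => i _.
  have : x i <= Num.max (x i - a) 0 + c1 + (if c1 < x i then a - c1 else 0).
    have := pos_ge0 (x i - a); have : x i - a <= Num.max (x i - a) 0 by rewrite le_max lexx.
    by case: ltP; lra.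
  by move/(ler_wpM2l (u0' i)); case: ifP => _; lra.
have sumy : \sum_j v j * y j <= Y - c1 + (if c1 < - d then (c1 + d) * (1 - al) else 0).
  case: ltP => cd.
    apply: (@le_trans _ _ (Y + d - (c1 + d) * \sum_(j | d < y j) v j)); last first.
      have : (c1 + d) * al <= (c1 + d) * \sum_(j | d < y j) v j.
        by apply: ler_wnM2l => //; lra.
      lra.
    rewrite -[X in _ + X - _]mulr1 -{1}v1 (big_mkcond (fun j => d < y j)) !mulr_sumr.
    rewrite -sumrN -!big_split /=; apply: ler_sum => j _.
    have : y j <= Num.max (y j + c1) 0 + d - (if d < y j then c1 + d else 0).
      have := pos_ge0 (y j + c1); have : y j + c1 <= Num.max (y j + c1) 0 by rewrite le_max lexx.
      by case: ltP; lra.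
    by move/(ler_wpM2l (v0' j)); case: ifP => _; lra.
  rewrite addr0 -[X in _ - X]mulr1 -v1 mulr_sumr -sumrN -big_split /=.
  apply: ler_sum => j _.
  have : y j + c1 <= Num.max (y j + c1) 0 by rewrite le_max lexx.
  by move/(ler_wpM2l (v0' j)); lra.
have sumxy : \sum_i u i * x i + \sum_j v j * y j <= X + Y.
  have : (a - c1) * (1 - al) + (if c1 < - d then (c1 + d) * (1 - al) else 0) = 0.
    by rewrite /a maxEle; case: ltgtP => [_|_|->]; ring.
  by move: sumx sumy; lra.
set S := \sum_i \sum_(j | _) _.
have SX : (g + g' - 1) / 2 * X <= S.
  rewrite /X mulr_sumr; apply: ler_sum => i _.
  under [leRHS]eq_bigr do rewrite -mulrA.
  rewrite -mulr_sumr mulrCA; apply: ler_wpM2l => //.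
  have := dense_row_pos_part (x i) v0' v1 (row i) al_a.
  by rewrite (_ : g + al - 1 = (g + g' - 1) / 2) //; rewrite /al; field.
have SY : (g + g' - 1) / 2 * Y <= S.
  rewrite /S (exchange_big_dep predT) //= /Y mulr_sumr; apply: ler_sum => j _.
  under [leRHS]eq_bigr do rewrite mulrAC mulrC.
  rewrite -mulr_sumr mulrCA; apply: ler_wpM2l => //.
  have c1l' : 1 - al <= \sum_(i | - - c1 <= x i) u i by rewrite opprK.
  have := dense_row_pos_part (y j) u0' u1 (col j) c1l'.
  rewrite opprK (_ : g' + (1 - al) - 1 = (g + g' - 1) / 2); last by rewrite /al; field.
  move/le_trans; apply; apply: ler_sum => i _.
  by rewrite [y j + _]addrC mulrC.
(* [S] dominates half the gap times [X] and also times [Y]; averaging the two costs the second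
   factor 2. *)
have dl0 : 0 <= (g + g' - 1) / 4 by lra.
have := ler_wpM2l dl0 sumxy; lra.
Qed.

Definition gibbs (R : realType) (I J : finType) (u : I -> R) (v : J -> R)
    (B : I -> J -> R) (x : I -> R) (y : J -> R) (i : I) (j : J) : R :=
  u i * x i * B i j * (v j * y j).

(** The dual objective of matrix scaling without its mass term, which equals 1 on every iterate. *)
Definition potential (R : realType) (I J : finType) (u : I -> R) (v : J -> R)
    (x : I -> R) (y : J -> R) : R :=
  \sum_i u i * ln (x i) + \sum_j v j * ln (y j).

(** Apply [dense_dual_bound] to [ln x - c] and [ln y], and bound the positive part of [z] by
    [expR z]. The shift [c] is chosen so that on [D] this exponential is at most a quarter of the
    gap times [B i j * (x i * y j)], whose weighted sum is at most the mass. *)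
Lemma potential_le (R : realType) (I J : finType) (u : I -> R) (v : J -> R)
    (B : I -> J -> R) (D : I -> J -> bool) (g g' rho : R) (x : I -> R) (y : J -> R) :
  dense_kernel u v B D g g' rho ->
  (forall i, 0 < x i) -> (forall j, 0 < y j) ->
  \sum_i \sum_j gibbs u v B x y i j <= 1 ->
  potential u v x y <= ln (4 / ((g + g' - 1) * rho)) + 1.
Proof.
move=> dk x0 y0 mass; case: (dk) => u0 v0 u1 v1 B0 _ BD _ _ /andP[r0 _] _ _ gap.
have d0 : 0 < g + g' - 1 by lra.
set c := ln _.
have ec : expR (- c) = (g + g' - 1) / 4 * rho.
  by rewrite expRN lnK ?posrE ?divr_gt0 ?mulr_gt0 // invf_div mulrAC.
have key : \sum_i \sum_(j | D i j) u i * v j * Num.max (ln (x i) - c + ln (y j)) 0 <=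
           (g + g' - 1) / 4.
  have d40 : 0 <= (g + g' - 1) / 4 by lra.
  apply: le_trans (ler_piMr d40 mass).
  rewrite mulr_sumr; apply: ler_sum => i _.
  rewrite mulr_sumr [leLHS]big_mkcond; apply: ler_sum => j _.
  have uv0 : 0 < u i * v j by rewrite mulr_gt0.
  case: ifP => [Dij|_]; last first.
    by rewrite mulr_ge0 // /gibbs !mulr_ge0 // ltW.
  have -> : (g + g' - 1) / 4 * gibbs u v B x y i j =
      u i * v j * ((g + g' - 1) / 4 * (B i j * (x i * y j))) by rewrite /gibbs; ring.
  apply: ler_wpM2l; first exact: ltW.
  apply: (@le_trans _ _ (expR (ln (x i) - c + ln (y j)))).
    by rewrite ge_max expR_ge0 andbT; apply: le_trans (expR_ge1Dx _); lra.
  rewrite addrAC expRD ec expRD !lnK ?posrE // mulrC -[leLHS]mulrA.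
  by apply: ler_wpM2l => //; apply: ler_wpM2r; [rewrite ltW // mulr_gt0 | exact: BD].
have := le_trans (dense_dual_bound (fun i => ln (x i) - c) (fun j => ln (y j)) dk) key.
rewrite -[leRHS]mulr1 ler_pM2l; last by lra.
under eq_bigr do rewrite mulrBr.
rewrite big_split sumrN /= -mulr_suml u1 /potential; lra.
Qed.

Lemma exists_le_average (R : realType) (I : finType) (w F : I -> R) (b : R) :
  (forall i, 0 < w i) -> 0 < \sum_i w i ->
  \sum_i w i * F i <= b * (\sum_i w i) -> exists i, F i <= b.
Proof.
move=> w0 wS; case: (pickP (fun i => F i <= b)) => [i ? _|no]; first by exists i.
rewrite leNgt => /negP[]; rewrite mulr_sumr; apply: ltr_sum => [|i _].
  case: (pickP I) => [i _|I0]; last by move: wS; rewrite big_pred0 ?ltxx.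
  by apply/hasP; exists i => //; rewrite mem_index_enum.
by rewrite mulrC ltr_pM2l // ltNge no.
Qed.

Lemma sum_block_ge (R : realType) (I J : finType) (A : I -> J -> R)
    (P : pred I) (Q : pred J) :
  (forall i j, 0 <= A i j) -> \sum_i \sum_j A i j = 1 ->
  \sum_(i | P i) \sum_j A i j + \sum_(j | Q j) \sum_i A i j - 1 <=
  \sum_(i | P i) \sum_(j | Q j) A i j.
Proof.
move=> A0 A1; rewrite [X in _ + X - _](exchange_big_dep predT) //= -A1.
under [X in _ + X - _]eq_bigr do under eq_bigl do rewrite andbT.
rewrite [X in X + _ - _]big_mkcond -big_split -sumrB [leRHS]big_mkcond /=.
apply: ler_sum => i _; case: (P i) => /=; first lra.
by rewrite add0r subr_le0; apply: ler_sum_subpred.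
Qed.

(* If the product of the two masses were large, then some row of [D] would
   carry little of [v y] and some column of [D] little of [u x]; the
   corresponding block would have small [gibbs] mass, although its marginals
   force at least half of the gap. *)
Lemma scaling_mass_le (R : realType) (I J : finType) (u : I -> R) (v : J -> R)
    (B : I -> J -> R) (D : I -> J -> bool) (g g' rho : R) (x : I -> R) (y : J -> R) :
  dense_kernel u v B D g g' rho ->
  (forall i, 0 < x i) -> (forall j, 0 < y j) ->
  (forall j, \sum_i gibbs u v B x y i j = v j) ->
  \sum_i `|u i - \sum_j gibbs u v B x y i j| <= (g + g' - 1) / 2 ->
  rho ^+ 2 * (g + g' - 1) * ((\sum_i u i * x i) * (\sum_j v j * y j)) <= 2.
Proof.
move=> dk x0 y0 colE err; case: (dk) => u0 v0 u1 v1 B0 B1 BD row col /andP[r0 _] _ _ gap.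
set X := \sum_i u i * x i; set Y := \sum_j v j * y j.
have ux0 i : 0 < u i * x i by rewrite mulr_gt0.
have vy0 j : 0 < v j * y j by rewrite mulr_gt0.
have A0 i j : 0 <= gibbs u v B x y i j by rewrite mulr_ge0 // /gibbs !mulr_ge0 // ltW.
have mass : \sum_i \sum_j gibbs u v B x y i j = 1.
  by rewrite exchange_big /= -v1; apply: eq_bigr.
have [iI _] : exists i : I, true.
  case: (pickP I) => [i _|I0]; first by exists i.
  by move: u1; rewrite big_pred0 // => /esym/eqP; rewrite oner_eq0.
have [jJ _] : exists j : J, true.
  case: (pickP J) => [j _|J0]; first by exists j.
  by move: v1; rewrite big_pred0 // => /esym/eqP; rewrite oner_eq0.
have X0 : 0 < X by rewrite /X (bigD1 iI) //= ltr_wpDr // sumr_ge0 // => i _; exact: ltW.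
have Y0 : 0 < Y by rewrite /Y (bigD1 jJ) //= ltr_wpDr // sumr_ge0 // => j _; exact: ltW.
have dense_mass : \sum_i \sum_(j | D i j) rho * (u i * x i * (v j * y j)) <= 1.
  rewrite -mass; apply: ler_sum => i _; rewrite [leLHS]big_mkcond.
  apply: ler_sum => j _; case: ifP => // /BD rB.
  rewrite /gibbs (_ : u i * x i * _ * _ = B i j * (u i * x i * (v j * y j))); last by ring.
  by rewrite ler_pM2r // mulr_gt0.
(* Average [dense_mass] over rows with weights [u i * x i]; the column case below is the same with
   weights [v j * y j]. *)
have [i hi] : exists i, rho * X * (\sum_(j | D i j) v j * y j) <= 1.
  apply: (exists_le_average ux0 X0); rewrite mul1r -/X -[leRHS]mulr1.
  apply: le_trans (ler_wpM2l (ltW X0) dense_mass).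
  rewrite [leRHS]mulr_sumr; apply: ler_sum => i _.
  have -> : \sum_(j | D i j) rho * (u i * x i * (v j * y j)) =
            rho * (u i * x i) * \sum_(j | D i j) v j * y j.
    by rewrite mulr_sumr; apply: eq_bigr => j _; ring.
  lra.
have [j hj] : exists j, rho * Y * (\sum_(i | D i j) u i * x i) <= 1.
  apply: (exists_le_average vy0 Y0); rewrite mul1r -/Y -[leRHS]mulr1.
  apply: le_trans (ler_wpM2l (ltW Y0) dense_mass).
  rewrite (exchange_big_dep predT) //= [leRHS]mulr_sumr; apply: ler_sum => j _.
  have -> : \sum_(k | D k j) rho * (u k * x k * (v j * y j)) =
            rho * (v j * y j) * \sum_(k | D k j) u k * x k.
    by rewrite mulr_sumr; apply: eq_bigr => k _; ring.
  lra.
(* The block consists of the rows dense in column [j] and the columns dense in row [i]. Its column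
   marginal is at least [g] exactly, its row marginal at least [g'] up to an error of half the
   gap. *)
have := sum_block_ge (fun k => D k j) (fun k => D i k) A0 mass.
have -> : \sum_(k | D i k) \sum_k' gibbs u v B x y k' k = \sum_(k | D i k) v k.
  by apply: eq_bigr.
have rowP : \sum_(k | D k j) u k - (g + g' - 1) / 2 <=
            \sum_(k | D k j) \sum_l gibbs u v B x y k l.
  rewrite lerBlDr -lerBlDl -sumrB; apply: le_trans err.
  apply: (@le_trans _ _ (\sum_(k | D k j) `|u k - \sum_l gibbs u v B x y k l|)).
    by apply: ler_sum => k _; apply: ler_norm.
  exact: ler_sum_subpred.
have blk : \sum_(k | D k j) \sum_(l | D i l) gibbs u v B x y k l <=
           (\sum_(k | D k j) u k * x k) * (\sum_(l | D i l) v l * y l).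
  rewrite mulr_suml; apply: ler_sum => k _; rewrite mulr_sumr; apply: ler_sum => l _.
  by rewrite ler_pM2r //; apply: ler_piMr => //; exact: ltW.
move=> h; have {h} : (g + g' - 1) / 2 <=
    (\sum_(k | D k j) u k * x k) * (\sum_(l | D i l) v l * y l).
  by have := row i; have := col j; lra.
set p := \sum_(k | _) _ in hj *; set q := \sum_(k | _) _ in hi * => pq.
have q0 : 0 <= q by rewrite sumr_ge0 // => ? _; exact: ltW.
have p0 : 0 <= p by rewrite sumr_ge0 // => ? _; exact: ltW.
have h1 : (rho * X * q) * (rho * Y * p) <= 1.
  by rewrite mulr_ile1 // !mulr_ge0 // ltW.
have h2 : 0 <= rho ^+ 2 * (X * Y) by rewrite !mulr_ge0 ?sqr_ge0 // ltW.
have := ler_wpM2l h2 pq; lra.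
Qed.

(** * Contraction of the marginal error *)

(** The positive and negative parts of [e] have a common mass [s]. Pairing them by the product
    coupling writes [s] times the image of [e] as a combination of differences of two rows of [K],
    each of l1 norm [2 * (1 - overlap)]. *)
Lemma dobrushin_contraction (R : realType) (I J : finType) (K : I -> J -> R)
    (e : I -> R) (eta : R) :
  (forall i, \sum_j K i j = 1) ->
  (forall i k, eta <= \sum_j Num.min (K i j) (K k j)) ->
  \sum_i e i = 0 ->
  \sum_j `|\sum_i e i * K i j| <= (1 - eta) * \sum_i `|e i|.
Proof.
move=> K1 Keta e0.
pose p i := Num.max (e i) 0; pose n i := Num.max (- e i) 0.
have p0 i : 0 <= p i by rewrite le_max lexx orbT.
have n0 i : 0 <= n i by rewrite le_max lexx orbT.
have epn i : e i = p i - n i.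
  rewrite /p /n; case: (leP 0 (e i)) => h.
    by rewrite max_r ?oppr_le0 // subr0.
  by rewrite max_l ?oppr_ge0 ?ltW // sub0r opprK.
have npn i : `|e i| = p i + n i.
  rewrite /p /n; case: (leP 0 (e i)) => h.
    by rewrite ger0_norm // max_r ?oppr_le0 // addr0.
  by rewrite ltr0_norm // max_l ?add0r // oppr_ge0 ltW.
pose s := \sum_i p i.
have sn : \sum_i n i = s.
  by apply/eqP; rewrite eq_sym -subr_eq0 /s -sumrB -{2}e0; apply/eqP/eq_bigr => i _; rewrite epn.
have nE : \sum_i `|e i| = 2 * s.
  by rewrite (eq_bigr _ (fun i _ => npn i)) big_split /= sn -/s; ring.
have s0 : 0 <= s by apply: sumr_ge0.
case: (eqVneq s 0) => [sz|sz].
  have ez i : e i = 0.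
    apply/eqP; rewrite -normr_eq0; apply/eqP.
    have e00 : \sum_i `|e i| = 0 by rewrite nE sz mulr0.
    exact: (psumr_eq0P (fun i _ => normr_ge0 (e i)) e00 (i := i)).
  by rewrite nE sz !mulr0 big1 // => j _; rewrite big1 ?normr0 // => i _; rewrite ez mul0r.
have sp : 0 < s by rewrite lt_def sz.
rewrite -(ler_pM2l sp) nE mulr_sumr.
have -> : s * ((1 - eta) * (2 * s)) =
    \sum_i \sum_k p i * n k * (2 * (1 - eta)).
  under eq_bigr do rewrite -mulr_suml -mulr_sumr sn.
  by rewrite -!mulr_suml -/s; ring.
apply: (@le_trans _ _ (\sum_j \sum_i \sum_k p i * n k * `|K i j - K k j|)).
  apply: ler_sum => j _; rewrite -[X in X * _]gtr0_norm // -normrM.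
  have -> : s * (\sum_i e i * K i j) = \sum_i \sum_k p i * n k * (K i j - K k j).
    under [RHS]eq_bigr => i _.
      under eq_bigr do rewrite mulrBr.
      rewrite sumrB -mulr_suml -mulr_sumr sn.
      over.
    rewrite sumrB [X in _ - X]exchange_big /=.
    under [X in _ - X]eq_bigr do rewrite -!mulr_suml -/s.
    rewrite -sumrB mulr_sumr; apply: eq_bigr => i _; rewrite epn; ring.
  apply: le_trans (ler_norm_sum _ _ _) _; apply: ler_sum => i _.
  apply: le_trans (ler_norm_sum _ _ _) _; apply: ler_sum => k _.
  by rewrite normrM ger0_norm // mulr_ge0.
rewrite exchange_big; apply: ler_sum => i _.
rewrite exchange_big; apply: ler_sum => k _.
rewrite -mulr_sumr; apply: ler_wpM2l; first exact: mulr_ge0.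
have -> : \sum_j `|K i j - K k j| = 2 * (1 - \sum_j Num.min (K i j) (K k j)).
  have -> : 2 * (1 - \sum_j Num.min (K i j) (K k j)) =
      \sum_j K i j + \sum_j K k j - 2 * \sum_j Num.min (K i j) (K k j).
    by rewrite !K1; ring.
  rewrite mulr_sumr -big_split -sumrB /=; apply: eq_bigr => j _.
  by rewrite minr_absE; field.
by apply: ler_wpM2l => //; rewrite lerD2l lerN2.
Qed.

Lemma gibbs_tr (R : realType) (I J : finType) (u : I -> R) (v : J -> R)
    (B : I -> J -> R) (x : I -> R) (y : J -> R) i j :
  gibbs v u (fun j i => B i j) y x j i = gibbs u v B x y i j.
Proof. by rewrite /gibbs; ring. Qed.

Lemma exists_dense (R : realType) (I J : finType) (u : I -> R) (v : J -> R)
    (B : I -> J -> R) (D : I -> J -> bool) (g g' rho : R) (i : I) :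
  dense_kernel u v B D g g' rho -> exists j, 0 < B i j.
Proof.
move=> dk; case: (pickP (D i)) => [j Dij|D0].
  by exists j; apply: lt_le_trans (dk_dense dk Dij); case/andP: (dk_rho dk).
by have := dk_row dk i; rewrite big_pred0 // leNgt; case/andP: (dk_g dk) => ->.
Qed.

Lemma gibbs_row_gt0 (R : realType) (I J : finType) (u : I -> R) (v : J -> R)
    (B : I -> J -> R) (D : I -> J -> bool) (g g' rho : R) (x : I -> R) (y : J -> R) (i : I) :
  dense_kernel u v B D g g' rho ->
  (forall i, 0 < x i) -> (forall j, 0 < y j) ->
  0 < \sum_j gibbs u v B x y i j.
Proof.
move=> dk x0 y0; have [j Bij] := exists_dense i dk.
have ? := dk_u_gt0 dk; have ? := dk_v_gt0 dk; have ? := dk_ge0 dk.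
rewrite (bigD1 j) //= ltr_wpDr //; last by rewrite /gibbs !mulr_gt0.
by rewrite sumr_ge0 // => l _; rewrite /gibbs !mulr_ge0 // ltW.
Qed.

(** As [B <= 1], the column equation forces [X * y j >= 1] and the row sum is at most
    [u i * x i * Y]. On [D] the ratio is therefore at least [rho * v j / (X * Y)], and
    [scaling_mass_le] bounds [X * Y]. *)
Lemma gibbs_kernel_ge (R : realType) (I J : finType) (u : I -> R) (v : J -> R)
    (B : I -> J -> R) (D : I -> J -> bool) (g g' rho : R) (x : I -> R) (y : J -> R) i j :
  dense_kernel u v B D g g' rho ->
  (forall i, 0 < x i) -> (forall j, 0 < y j) ->
  (forall j, \sum_i gibbs u v B x y i j = v j) ->
  \sum_i `|u i - \sum_j gibbs u v B x y i j| <= (g + g' - 1) / 2 ->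
  D i j ->
  rho ^+ 3 * (g + g' - 1) / 2 * v j <=
  gibbs u v B x y i j / \sum_l gibbs u v B x y i l.
Proof.
move=> dk x0 y0 colE err Dij; have Z := scaling_mass_le dk x0 y0 colE err.
have r0 := gibbs_row_gt0 i dk x0 y0.
have u0 := dk_u_gt0 dk; have v0 := dk_v_gt0 dk; have B0 := dk_ge0 dk.
have B1 := dk_le1 dk; have rB := dk_dense dk Dij; have gap := dk_gap dk.
have [rho0 rho1] := andP (dk_rho dk).
set X := \sum_i _ in Z; set Y := \sum_j _ in Z.
have Xy : 1 <= X * y j.
  rewrite -(ler_pM2l (v0 j)) mulr1 -{1}colE mulrCA mulr_suml; apply: ler_sum => k _.
  by rewrite /gibbs ler_pM2r ?mulr_gt0 //; apply: ler_piMr => //; rewrite ltW // mulr_gt0.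
have rY : \sum_l gibbs u v B x y i l <= u i * x i * Y.
  rewrite mulr_sumr; apply: ler_sum => l _.
  by rewrite /gibbs ler_pM2r ?mulr_gt0 //; apply: ler_piMr => //; rewrite ltW // mulr_gt0.
have Y0 : 0 <= Y by rewrite sumr_ge0 // => l _; rewrite ltW // mulr_gt0.
have ryY : rho ^+ 3 * (g + g' - 1) / 2 * Y <= rho * y j.
  have h1 : 0 <= rho ^+ 3 * (g + g' - 1) / 2 * Y.
    by rewrite mulr_ge0 // divr_ge0 // mulr_ge0 ?exprn_ge0 ?ltW // subr_gt0.
  have h2 : 0 <= rho * y j / 2 by rewrite divr_ge0 // ltW // mulr_gt0.
  have := ler_wpM2l h1 Xy; have := ler_wpM2l h2 Z; lra.
rewrite ler_pdivlMr //.
apply: (@le_trans _ _ (rho ^+ 3 * (g + g' - 1) / 2 * v j * (u i * x i * Y))).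
  apply: ler_wpM2l => //.
  by rewrite mulr_ge0 ?(ltW (v0 j)) // divr_ge0 // mulr_ge0 ?exprn_ge0 ?ltW // subr_gt0.
have h3 : 0 <= u i * x i * v j by rewrite ltW // !mulr_gt0.
apply: (@le_trans _ _ (u i * x i * v j * (rho * y j))).
  by have := ler_wpM2l h3 ryY; lra.
have h4 : 0 <= u i * x i * (v j * y j) by rewrite ltW // !mulr_gt0.
by have := ler_wpM2l h4 rB; rewrite /gibbs; lra.
Qed.

Lemma row_step (R : realType) (I J : finType) (u : I -> R) (v : J -> R)
    (B : I -> J -> R) (D : I -> J -> bool) (g g' rho : R) (x : I -> R) (y : J -> R) :
  dense_kernel u v B D g g' rho ->
  (forall i, 0 < x i) -> (forall j, 0 < y j) ->
  (forall j, \sum_i gibbs u v B x y i j = v j) ->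
  let E := \sum_i `|u i - \sum_j gibbs u v B x y i j| in
  exists x', let E' := \sum_j `|v j - \sum_i gibbs u v B x' y i j| in
  [/\ forall i, 0 < x' i,
      forall i j, gibbs u v B x' y i j =
        u i * gibbs u v B x y i j / \sum_l gibbs u v B x y i l,
      forall i, \sum_j gibbs u v B x' y i j = u i
    & [/\ forall lam, potential u v x y + (lam * E - lam ^+ 2) <= potential u v x' y,
          E' <= E
        & g' <= g -> E <= (g + g' - 1) / 2 ->
          E' <= (1 - rho ^+ 3 * (g + g' - 1) ^+ 2 / 2) * E]].
Proof.
move=> dk x0 y0 colE E.
have u0 := dk_u_gt0 dk; have v0 := dk_v_gt0 dk; have B0 := dk_ge0 dk; have gap := dk_gap dk.
have u1 := dk_u_sum dk; have v1 := dk_v_sum dk; have [rho0 rho1] := andP (dk_rho dk).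
pose r i := \sum_l gibbs u v B x y i l.
have r0 i : 0 < r i := gibbs_row_gt0 i dk x0 y0.
have rS : \sum_i r i = 1 by rewrite /r exchange_big /= -v1; apply: eq_bigr.
have A0 i j : 0 <= gibbs u v B x y i j by rewrite /gibbs !mulr_ge0 // ltW.
pose K i j := gibbs u v B x y i j / r i.
have K0 i j : 0 <= K i j by rewrite /K divr_ge0 // ltW.
have K1 i : \sum_j K i j = 1 by rewrite /K -mulr_suml -/(r i) divff ?lt0r_neq0.
have gibbsE i j : gibbs u v B (fun i => x i * (u i / r i)) y i j =
                  u i * gibbs u v B x y i j / r i by rewrite /gibbs; ring.
exists (fun i => x i * (u i / r i)); split => //.
- by move=> i; rewrite mulr_gt0 // divr_gt0.
- move=> i; under eq_bigr do rewrite gibbsE -mulrA.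
  by rewrite -mulr_sumr K1 mulr1.
(* The old column sums are exact, so [v] is the image of [r] under [K], while the new column sums
   are the image of [u]. *)
have errE : \sum_j `|v j - \sum_i gibbs u v B (fun i => x i * (u i / r i)) y i j| =
            \sum_j `|\sum_i (u i - r i) * K i j|.
  apply: eq_bigr => j _; rewrite distrC -colE -sumrB; congr `|_|.
  apply: eq_bigr => i _; rewrite gibbsE /K; field; exact: lt0r_neq0.
have e0 : \sum_i (u i - r i) = 0 by rewrite sumrB u1 rS subrr.
split.
- move=> lam.
  have -> : potential u v (fun i => x i * (u i / r i)) y =
            potential u v x y + \sum_i u i * ln (u i / r i).
    rewrite /potential addrAC -big_split /=; congr (_ + _); apply: eq_bigr => i _.
    by rewrite lnM ?posrE ?divr_gt0 // mulrDr.
  by rewrite lerD2l; apply: relative_entropy_ge.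
(* Monotonicity is the contraction lemma with overlap 0. *)
- rewrite errE -[leRHS]mul1r -[X in _ <= X * _]subr0; apply: dobrushin_contraction => // i k.
  by apply: sumr_ge0 => j _; rewrite le_min !K0.
move=> g'g Ed; rewrite errE; apply: dobrushin_contraction => // i k.
(* Two rows share dense columns of weight at least [2 * g - 1], which is at least [g + g' - 1]
   because [g' <= g]. *)
have h := sum_setI_ge (fun j => ltW (v0 j)) v1 (dk_row dk i) (dk_row dk k).
pose c := rho ^+ 3 * (g + g' - 1) / 2.
have c0 : 0 <= c by rewrite divr_ge0 // mulr_ge0 ?exprn_ge0 ?ltW // subr_gt0.
apply: (@le_trans _ _ (\sum_(j | D i j && D k j) c * v j)).
  have : c * (g + g' - 1) <= c * \sum_(j | D i j && D k j) v j by apply: ler_wpM2l => //; lra.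
  by rewrite -mulr_sumr /c; lra.
rewrite [leLHS]big_mkcond; apply: ler_sum => j _; case: ifP => [/andP[Dij Dkj]|_].
  by rewrite le_min !(gibbs_kernel_ge dk).
by rewrite le_min !K0.
Qed.

(** * Sinkhorn-Knopp iterates *)

Definition marginal_error (R : realType) (m n : nat) (u : 'rV[R]_m) (v : 'rV[R]_n)
    (A : 'M[R]_(m, n)) : R :=
  l1norm (row_sums A - u) + l1norm (col_sums A - v).

Lemma marginal_errorE (R : realType) (m n : nat) (u : 'rV[R]_m) (v : 'rV[R]_n)
    (A : 'M[R]_(m, n)) :
  marginal_error u v A =
  \sum_i `|u 0 i - \sum_j A i j| + \sum_j `|v 0 j - \sum_i A i j|.
Proof. by congr (_ + _); apply: eq_bigr => k _; rewrite !mxE distrC. Qed.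

(** The parity clause records which marginal the last scaling made exact; that exactness is what the
    next half-step requires. *)
Definition SK_scaling (R : realType) (m n : nat) (B : 'M[R]_(m, n))
    (u : 'rV[R]_m) (v : 'rV[R]_n) (k : nat) (x : 'I_m -> R) (y : 'I_n -> R) : Prop :=
  [/\ forall i, 0 < x i, forall j, 0 < y j,
      forall i j, SK B u v k i j = gibbs (u 0) (v 0) B x y i j
    & if odd k then forall j, \sum_i SK B u v k i j = v 0 j
      else forall i, \sum_j SK B u v k i j = u 0 i].

Lemma SK_scaling0 (R : realType) (m n : nat) (B : 'M[R]_(m, n))
    (u : 'rV[R]_m) (v : 'rV[R]_n) (D : 'I_m -> 'I_n -> bool) (g g' rho : R) :
  dense_kernel (u 0) (v 0) B D g g' rho ->
  exists x y, SK_scaling B u v 0 x y /\ - ln n%:R <= potential (u 0) (v 0) x y.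
Proof.
move=> dk; have v0 := dk_v_gt0 dk; have u0 := dk_u_gt0 dk.
have r0 i : 0 < \sum_j B i j.
  have [j Bij] := exists_dense i dk.
  by rewrite (bigD1 j) //= ltr_wpDr // sumr_ge0 // => l _; apply: (dk_ge0 dk).
have rn i : \sum_j B i j <= n%:R.
  apply: (@le_trans _ _ (\sum_(j < n) 1)); last by rewrite sumr_const card_ord.
  by apply: ler_sum => j _; apply: (dk_le1 dk).
(* This [y] cancels the weight [v], since no column scaling has happened yet. Its part of the
   potential is nonnegative because [v <= 1]. *)
exists (fun i => (\sum_j B i j)^-1), (fun j => (v 0 j)^-1); split.
  split=> [i|j|i j|i]; rewrite ?invr_gt0 //.
    rewrite !mxE /gibbs divff ?lt0r_neq0 //; ring.
  under eq_bigr do rewrite !mxE mulrAC.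
  by rewrite -mulr_sumr mulfVK ?lt0r_neq0.
rewrite /potential -[leLHS]addr0; apply: lerD; last first.
  apply: sumr_ge0 => j _; rewrite mulr_ge0 ?(ltW (v0 j)) // ln_ge0 // invf_ge1 //.
  rewrite -(dk_v_sum dk) (bigD1 j) //= lerDl sumr_ge0 // => l _; exact: ltW.
rewrite -[leLHS]mul1r -[X in X * _](dk_u_sum dk) mulr_suml; apply: ler_sum => i _.
apply: ler_wpM2l; first exact: ltW.
have n0 := lt_le_trans (r0 i) (rn i).
by rewrite lnV ?posrE // lerN2 ler_ln ?posrE.
Qed.

Lemma SK_scalingS (R : realType) (m n : nat) (B : 'M[R]_(m, n))
    (u : 'rV[R]_m) (v : 'rV[R]_n) (D : 'I_m -> 'I_n -> bool) (g g' rho : R)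
    (k : nat) (x : 'I_m -> R) (y : 'I_n -> R) :
  dense_kernel (u 0) (v 0) B D g g' rho -> SK_scaling B u v k x y ->
  let E := marginal_error u v (SK B u v k) in
  let E' := marginal_error u v (SK B u v k.+1) in
  exists x' y', [/\ SK_scaling B u v k.+1 x' y',
    forall lam, potential (u 0) (v 0) x y + (lam * E - lam ^+ 2) <=
                potential (u 0) (v 0) x' y',
    E' <= E
  & (if odd k then g' <= g else g <= g') -> E <= (g + g' - 1) / 2 ->
    E' <= (1 - rho ^+ 3 * (g + g' - 1) ^+ 2 / 2) * E].
Proof.
move=> dk [x0 y0 SKE]; rewrite !marginal_errorE /SK_scaling oddS [SK _ _ _ k.+1]/=.
case: ifP => /= _ marg.
  have colE j : \sum_i gibbs (u 0) (v 0) B x y i j = v 0 j.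
    by rewrite -marg; apply: eq_bigr => i _; rewrite SKE.
  have [x' [x'0 gE rowE [pot mono contr]]] := row_step dk x0 y0 colE.
  have SE i j : scale_rows u (SK B u v k) i j = gibbs (u 0) (v 0) B x' y i j.
    by rewrite gE !mxE SKE; under eq_bigr do rewrite SKE.
  have E1 : \sum_i `|u 0 i - \sum_j SK B u v k i j| =
            \sum_i `|u 0 i - \sum_j gibbs (u 0) (v 0) B x y i j|.
    by apply: eq_bigr => i _; under eq_bigr do rewrite SKE.
  have E2 : \sum_j `|v 0 j - \sum_i scale_rows u (SK B u v k) i j| =
            \sum_j `|v 0 j - \sum_i gibbs (u 0) (v 0) B x' y i j|.
    by apply: eq_bigr => i _; under eq_bigr do rewrite SE.
  have Z1 : \sum_j `|v 0 j - \sum_i SK B u v k i j| = 0.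
    by rewrite big1 // => j _; rewrite marg subrr normr0.
  have rowE' i : \sum_j scale_rows u (SK B u v k) i j = u 0 i.
    by rewrite -rowE; apply: eq_bigr => j _; rewrite SE.
  have Z2 : \sum_i `|u 0 i - \sum_j scale_rows u (SK B u v k) i j| = 0.
    by rewrite big1 // => j _; rewrite rowE' subrr normr0.
  by exists x', y; rewrite Z1 Z2 E1 E2 addr0 add0r.
(* At even [k] the rows are exact, and the coming column scaling is a row step of the transposed
   kernel. *)
have rowE i : \sum_j gibbs (v 0) (u 0) (fun j i => B i j) y x j i = u 0 i.
  by rewrite -marg; apply: eq_bigr => j _; rewrite SKE gibbs_tr.
have [y' [y'0 gE colE [pot mono contr]]] := row_step (dense_kernel_tr dk) y0 x0 rowE.
have SE i j : scale_cols v (SK B u v k) i j = gibbs (u 0) (v 0) B x y' i j.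
  rewrite -gibbs_tr gE !mxE SKE gibbs_tr.
  by under eq_bigr do rewrite SKE -gibbs_tr.
have E1 : \sum_j `|v 0 j - \sum_i SK B u v k i j| =
          \sum_j `|v 0 j - \sum_i gibbs (v 0) (u 0) (fun j i => B i j) y x j i|.
  by apply: eq_bigr => i _; under eq_bigr do rewrite SKE -gibbs_tr.
have E2 : \sum_i `|u 0 i - \sum_j scale_cols v (SK B u v k) i j| =
          \sum_i `|u 0 i - \sum_j gibbs (v 0) (u 0) (fun j i => B i j) y' x j i|.
  by apply: eq_bigr => i _; under eq_bigr do rewrite SE -gibbs_tr.
have Z1 : \sum_i `|u 0 i - \sum_j SK B u v k i j| = 0.
  by rewrite big1 // => j _; rewrite marg subrr normr0.
have colE' j : \sum_i scale_cols v (SK B u v k) i j = v 0 j.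
  by rewrite -colE; apply: eq_bigr => i _; rewrite SE gibbs_tr.
have Z2 : \sum_j `|v 0 j - \sum_i scale_cols v (SK B u v k) i j| = 0.
  by rewrite big1 // => j _; rewrite colE' subrr normr0.
exists x, y'; rewrite Z1 Z2 E1 E2 addr0 add0r [g + g']addrC; split => // lam.
by have := pot lam; rewrite /potential; lra.
Qed.

(** * Decay of the error along the iteration *)

Section ErrorDecay.
Context (R : realType) (m n : nat) (B : 'M[R]_(m, n)) (u : 'rV[R]_m) (v : 'rV[R]_n).
Context (D : 'I_m -> 'I_n -> bool) (g g' rho : R).
Context (dk : dense_kernel (u 0) (v 0) B D g g' rho).
Let E k := marginal_error u v (SK B u v k).

Lemma SK_scaling_potential (lam : R) (k : nat) :
  exists x y, SK_scaling B u v k x y /\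
    - ln n%:R + \sum_(j < k) (lam * E j - lam ^+ 2) <= potential (u 0) (v 0) x y.
Proof.
elim: k => [|k [x [y [st pot]]]].
  by have [x [y st]] := SK_scaling0 dk; exists x, y; rewrite big_ord0 addr0.
have [x' [y' [st' pot' _ _]]] := SK_scalingS dk st; exists x', y'; split => //.
by rewrite big_ord_recr /= addrA; apply: le_trans (pot' lam); rewrite lerD2r.
Qed.

Lemma marginal_errorS_le (k : nat) : E k.+1 <= E k.
Proof.
have [x [y [st _]]] := SK_scaling_potential 0 k.
by have [x' [y' []]] := SK_scalingS dk st.
Qed.

Lemma marginal_error_ge0 (k : nat) : 0 <= E k.
Proof. by rewrite /E marginal_errorE addr_ge0 // sumr_ge0. Qed.

Lemma marginal_error_nincr (j k : nat) : (j <= k)%N -> E k <= E j.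
Proof.
move=> /subnK <-; elim: (k - j)%N => // l IH; rewrite addSn.
exact: le_trans (marginal_errorS_le _) IH.
Qed.

(** The error is nonincreasing, so all earlier errors also exceed half the gap [d]. With
    [lam = d / 4], optimal at error [d / 2], each half-step gains at least [d ^+ 2 / 16], and
    [potential_le] caps the total gain. *)
Lemma large_marginal_error_steps (k : nat) :
  (g + g' - 1) / 2 < E k ->
  k%:R * (g + g' - 1) ^+ 2 / 16 <= ln n%:R + ln (4 / ((g + g' - 1) * rho)) + 1.
Proof.
move=> Ek; have gap := dk_gap dk.
have [x [y [[x0 y0 SKE marg] pot]]] := SK_scaling_potential ((g + g' - 1) / 4) k.
have mass : \sum_i \sum_j gibbs (u 0) (v 0) B x y i j <= 1.
  under eq_bigr do under eq_bigr do rewrite -SKE.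
  case: ifP marg => _ marg.
    by rewrite exchange_big -(dk_v_sum dk); apply: ler_sum => j _; rewrite marg.
  by rewrite -(dk_u_sum dk); apply: ler_sum => i _; rewrite marg.
have := potential_le dk x0 y0 mass.
have : k%:R * (g + g' - 1) ^+ 2 / 16 <=
    \sum_(j < k) ((g + g' - 1) / 4 * E j - ((g + g' - 1) / 4) ^+ 2).
  have -> : k%:R * (g + g' - 1) ^+ 2 / 16 = \sum_(j < k) (g + g' - 1) ^+ 2 / 16.
    by rewrite sumr_const card_ord -[RHS]mulr_natl mulrA.
  apply: ler_sum => j _.
  have Ej : (g + g' - 1) / 2 <= E j.
    by apply: le_trans (ltW Ek) (marginal_error_nincr _); apply: ltnW.
  have d0 : 0 <= (g + g' - 1) / 4 by lra.
  have := ler_wpM2l d0 Ej; lra.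
lra.
Qed.

(** Only one parity of half-steps is known to contract, depending on which of [g], [g'] is larger;
    two consecutive half-steps contain one of that parity, and the other does not increase the
    error. *)
Lemma small_marginal_error_contracts (k : nat) :
  E k <= (g + g' - 1) / 2 ->
  E k.+2 <= (1 - rho ^+ 3 * (g + g' - 1) ^+ 2 / 2) * E k.
Proof.
move=> Ek.
have fac0 : 0 <= 1 - rho ^+ 3 * (g + g' - 1) ^+ 2 / 2.
  have [r0 r1] := andP (dk_rho dk); have gap := dk_gap dk.
  have [_ g1] := andP (dk_g dk); have [_ g'1] := andP (dk_g' dk).
  have h1 : rho ^+ 3 <= 1 by rewrite exprn_ile1 // ltW.
  have h2 : (g + g' - 1) ^+ 2 <= 1 by rewrite exprn_ile1; lra.
  have : rho ^+ 3 * (g + g' - 1) ^+ 2 <= 1.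
    by rewrite mulr_ile1 ?exprn_ge0 //; [exact: ltW | lra].
  lra.
have step l : (if odd l then g' <= g else g <= g') -> E l <= (g + g' - 1) / 2 ->
    E l.+1 <= (1 - rho ^+ 3 * (g + g' - 1) ^+ 2 / 2) * E l.
  have [x [y [st _]]] := SK_scaling_potential 0 l.
  by have [x' [y' []]] := SK_scalingS dk st.
have [ok|nok] := boolP (if odd k then g' <= g else g <= g').
  exact: le_trans (marginal_errorS_le _) (step _ ok Ek).
have ok : if odd k.+1 then g' <= g else g <= g'.
  by rewrite oddS; case: (odd k) nok => /=; rewrite -ltNge => /ltW.
apply: le_trans (step _ ok (le_trans (marginal_errorS_le _) Ek)) _.
by apply: ler_wpM2l => //; exact: marginal_errorS_le.
Qed.

Lemma marginal_error_geometric (k s : nat) :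
  E k <= (g + g' - 1) / 2 ->
  E (k + s.*2)%N <= expR (- (s%:R * (rho ^+ 3 * (g + g' - 1) ^+ 2 / 2))).
Proof.
move=> Ek; set eta := rho ^+ 3 * (g + g' - 1) ^+ 2 / 2.
elim: s => [|s IH].
  rewrite addn0 mul0r oppr0 expR0; apply: le_trans Ek _.
  have [_ g1] := andP (dk_g dk); have [_ g'1] := andP (dk_g' dk); lra.
rewrite doubleS !addnS.
have Eks : E (k + s.*2)%N <= (g + g' - 1) / 2.
  exact: le_trans (marginal_error_nincr (leq_addr _ _)) Ek.
apply: le_trans (small_marginal_error_contracts Eks) _; rewrite -/eta.
rewrite -(natr1 s) [in leRHS]mulrDl mul1r opprD expRD [leRHS]mulrC.
apply: (@le_trans _ _ (expR (- eta) * E (k + s.*2)%N)).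
  by apply: ler_wpM2r; [exact: marginal_error_ge0 | exact: expR_ge1Dx].
by apply: ler_wpM2l => //; exact: expR_ge0.
Qed.
End ErrorDecay.

(** * Explicit iteration count *)

Lemma half_le_ln2 (R : realType) : 2^-1 <= ln 2 :> R.
Proof.
have h : (0 : R) < 2^-1 by lra.
by have := ln_le_subr1 h; rewrite lnV ?posrE //; lra.
Qed.

Lemma marginal_error_le_eps (R : realType) (m n : nat) (B : 'M[R]_(m, n))
    (u : 'rV[R]_m) (v : 'rV[R]_n) (D : 'I_m -> 'I_n -> bool) (g g' rho eps : R) :
  dense_kernel (u 0) (v 0) B D g g' rho -> (1 < n)%N -> 0 < eps <= 1 ->
  exists k : nat,
    k%:R <= 200 * (rho ^- 14 * (g + g' - 1) ^- 6
                   * (ln n%:R - ln eps - ln rho - ln (g + g' - 1))) /\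
    marginal_error u v (SK B u v k) <= eps.
Proof.
move=> dk n1 /andP[eps0 eps1].
have [r0 r1] := andP (dk_rho dk); have gap := dk_gap dk.
have [_ g1] := andP (dk_g dk); have [_ g'1] := andP (dk_g' dk).
have d0 : 0 < g + g' - 1 by lra.
have d1 : g + g' - 1 <= 1 by lra.
have small := @large_marginal_error_steps _ _ _ _ _ _ _ _ _ _ dk.
have geo := @marginal_error_geometric _ _ _ _ _ _ _ _ _ _ dk.
set d := g + g' - 1 in d0 d1 small geo *.
pose a := rho^-1; pose b := d^-1.
have a1 : 1 <= a by rewrite invf_ge1.
have b1 : 1 <= b by rewrite invf_ge1.
have a0 : 0 <= a by lra.
have b0 : 0 <= b by lra.
have -> : rho ^- 14 = a ^+ 14 by rewrite exprVn.
have -> : d ^- 6 = b ^+ 6 by rewrite exprVn.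
have lnr : ln rho <= 0 by apply: ln_le0.
have lnd : ln d <= 0 by apply: ln_le0.
have lne : ln eps <= 0 by apply: ln_le0.
(* For [n >= 2] this keeps [P] at least 1/2, so that additive constants are absorbed into multiples
   of [P]. *)
have lnn : 2^-1 <= ln n%:R :> R.
  apply: le_trans (half_le_ln2 R) _; rewrite ler_ln ?posrE ?ltr0n ?ler_nat //.
  exact: ltnW.
set W := ln n%:R + ln (4 / (d * rho)) + 1 in small.
set P := ln n%:R - ln eps - ln rho - ln d.
(* [W] is at most [P + 4], and [4 <= 8 * P]. *)
have WP : W <= 9 * P.
  have four : ln 4 <= 3 :> R.
    have h : (0 : R) < 4 by lra.
    have := ln_le_subr1 h; lra.
  rewrite /W lnM ?posrE ?invr_gt0 ?mulr_gt0 // lnV ?posrE ?mulr_gt0 // lnM ?posrE //.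
  rewrite /P; lra.
have W0 : 0 <= W.
  have : 0 <= ln (4 / (d * rho)).
    apply: ln_ge0; rewrite ler_pdivlMr ?mulr_gt0 // mul1r.
    have : d * rho <= 1 by rewrite mulr_ile1 // ltW.
    lra.
  by rewrite /W; lra.
(* [k1] half-steps bring the error down to [d / 2]; then [s] double steps, each contracting by
   [1 - rho ^+ 3 * d ^+ 2 / 2], bring it down to [eps]. *)
pose k1 := (Num.truncn (16 * b ^+ 2 * W)).+1.
pose s := (Num.truncn (2 * a ^+ 3 * b ^+ 2 * - ln eps)).+1.
have b20 : 0 <= b ^+ 2 by apply: exprn_ge0.
have b2 : b ^+ 2 * d ^+ 2 = 1 by rewrite exprVn mulVf // expf_neq0 // lt0r_neq0.
have a3 : a ^+ 3 * rho ^+ 3 = 1 by rewrite exprVn mulVf // expf_neq0 // lt0r_neq0.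
have Ek1 : marginal_error u v (SK B u v k1) <= d / 2.
  rewrite leNgt; apply/negP => /small h.
  have h1 : 16 * b ^+ 2 * W < k1%:R by apply: truncnS_gt.
  have d20 : 0 <= 16 * b ^+ 2 by rewrite mulr_ge0.
  have := ler_wpM2l d20 h.
  have -> : 16 * b ^+ 2 * (k1%:R * d ^+ 2 / 16) = (b ^+ 2 * d ^+ 2) * k1%:R by field.
  by rewrite b2 mul1r leNgt h1.
exists (k1 + s.*2)%N; split; last first.
  apply: le_trans (geo k1 s Ek1) _; rewrite -[leRHS]lnK ?posrE // ler_expR.
  have h1 : 2 * a ^+ 3 * b ^+ 2 * - ln eps < s%:R by apply: truncnS_gt.
  have e0 : 0 <= rho ^+ 3 * d ^+ 2 / 2.
    by rewrite divr_ge0 // mulr_ge0 ?exprn_ge0 ?ltW.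
  have := ler_wpM2r e0 (ltW h1).
  have -> : 2 * a ^+ 3 * b ^+ 2 * - ln eps * (rho ^+ 3 * d ^+ 2 / 2) =
            (a ^+ 3 * rho ^+ 3) * (b ^+ 2 * d ^+ 2) * - ln eps by field.
  by rewrite a3 b2; lra.
have k1le : k1%:R <= 16 * b ^+ 2 * W + 1.
  by rewrite -(natr1 (Num.truncn _)) lerD2r truncn_le !mulr_ge0.
have sle : s%:R <= 2 * a ^+ 3 * b ^+ 2 * - ln eps + 1.
  by rewrite -(natr1 (Num.truncn _)) lerD2r truncn_le !mulr_ge0 ?exprn_ge0 // oppr_ge0.
have P2 : 2^-1 <= P by rewrite /P; lra.
(* The count obtained is of order [a ^+ 3 * b ^+ 2 * P]; as [a] and [b] are at least 1, the powers
   can be raised. *)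
set Q := a ^+ 14 * b ^+ 6.
have Q1 : a ^+ 3 * b ^+ 2 <= Q.
  by rewrite ler_pM ?exprn_ge0 // ler_weXn2l.
have Q2 : b ^+ 2 <= a ^+ 3 * b ^+ 2 by rewrite ler_peMl // exprn_ege1.
have Q3 : 1 <= b ^+ 2 by rewrite exprn_ege1.
have bQ : b ^+ 2 <= Q := le_trans Q2 Q1.
have h1 : b ^+ 2 * W <= Q * (9 * P) by apply: ler_pM.
have h2 : a ^+ 3 * b ^+ 2 * - ln eps <= Q * P.
  apply: ler_pM => //; first by rewrite mulr_ge0 ?exprn_ge0.
    by rewrite oppr_ge0.
  by rewrite /P; lra.
have h3 : 1 * 2^-1 <= Q * P.
  by apply: ler_pM => //; [lra | exact: le_trans Q3 bQ].
(* The first phase costs [144 * (Q * P)], the second [4 * (Q * P)], and the rounding 3, which is at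
   most [6 * (Q * P)]. *)
by rewrite natrD -muln2 natrM; lra.
Qed.

(** * Normalization of the largest entry and conclusion *)

Lemma SK_scalemx (R : realType) (m n : nat) (a : R) (B : 'M[R]_(m, n))
    (u : 'rV[R]_m) (v : 'rV[R]_n) (k : nat) :
  a != 0 -> SK (a *: B) u v k = SK B u v k.
Proof.
move=> a0; elim: k => [|k IH]; last by rewrite /= IH.
apply/matrixP => i j; rewrite !mxE; under eq_bigr do rewrite mxE.
by rewrite -mulr_sumr mulrCA -mulf_div divff // mul1r.
Qed.

Lemma le_max_entry (R : realType) (m n : nat) (B : 'M[R]_(m, n)) i j :
  B i j <= max_entry B.
Proof.
apply: le_trans (le_bigmax _ (fun i => \big[Num.max/0]_(j < n) B i j) i).
exact: (le_bigmax _ (B i)).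
Qed.

Lemma sk_dense_kernel (R : realType) (gamma gamma' rho : R) (m n : nat)
    (u : 'rV[R]_m) (v : 'rV[R]_n) (B : 'M[R]_(m, n)) :
  0 < gamma <= 1 -> 0 < gamma' <= 1 -> 0 < rho <= 1 ->
  (forall i, 0 < u 0 i) -> (forall j, 0 < v 0 j) ->
  l1norm u = 1 -> l1norm v = 1 ->
  (forall i j, 0 <= B i j) -> 0 < max_entry B ->
  sk_dense gamma gamma' rho u v B -> 1 < gamma + gamma' ->
  dense_kernel (u 0) (v 0) ((max_entry B)^-1 *: B)
    (fun i j => rho * max_entry B < B i j) gamma gamma' rho.
Proof.
move=> ? ? ? u0 v0 u1 v1 B0 t0 [[_ rowD] [_ colD]] gap; split => //.
- by rewrite -u1; apply: eq_bigr => i _; rewrite ger0_norm // ltW.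
- by rewrite -v1; apply: eq_bigr => j _; rewrite ger0_norm // ltW.
- by move=> i j; rewrite mxE mulr_ge0 // invr_ge0 ltW.
- by move=> i j; rewrite mxE mulrC ler_pdivrMr // mul1r le_max_entry.
- by move=> i j /ltW; rewrite mxE [_^-1 * _]mulrC ler_pdivlMr.
- by move=> i; have := rowD i; rewrite v1 divr1.
- by move=> j; have := colD j; rewrite u1 divr1.
Qed.

Theorem theorem1p4 (R : realType) :
  exists C : R, 0 < C /\
  forall (gamma gamma' rho eps : R) (m n : nat)
    (u : 'rV[R]_m) (v : 'rV[R]_n) (B : 'M[R]_(m, n)),
  0 < gamma <= 1 -> 0 < gamma' <= 1 -> 0 < rho <= 1 -> 0 < eps <= 1 ->
  (0 < m)%N -> (0 < n)%N ->
  (forall i, 0 < u 0 i) -> (forall j, 0 < v 0 j) ->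
  l1norm u = 1 -> l1norm v = 1 ->
  (forall i j, 0 <= B i j) -> B != 0 ->
  sk_dense gamma gamma' rho u v B ->
  1 < gamma + gamma' ->
  exists k : nat,
    k%:R <= C * (rho ^- 14 * (gamma + gamma' - 1) ^- 6
                 * (ln n%:R - ln eps - ln rho - ln (gamma + gamma' - 1))) /\
    l1norm (row_sums (SK B u v k) - u) + l1norm (col_sums (SK B u v k) - v)
      <= eps.
Proof.
exists 200; split=> // gamma gamma' rho eps m n u v B gammaP gamma'P rhoP epsP _ n0.
move=> u0 v0 u1 v1 B0 Bn0 dense gap.
have t0 : 0 < max_entry B.
  rewrite ltNge; apply: contra Bn0 => t_le0; apply/eqP/matrixP => i j.
  by rewrite mxE; apply/eqP; rewrite eq_le B0 (le_trans (le_max_entry _ _ _) t_le0).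
have dk := sk_dense_kernel gammaP gamma'P rhoP u0 v0 u1 v1 B0 t0 dense gap.
(* The initial row scaling cancels the normalizing factor. *)
have SKE k : SK ((max_entry B)^-1 *: B) u v k = SK B u v k.
  by rewrite SK_scalemx // invr_eq0 lt0r_neq0.
case: (ltngtP n 1%N) => [|n1|n1]; first by rewrite ltnNge n0.
  by have [k] := marginal_error_le_eps dk n1 epsP; rewrite SKE; exists k.
(* For [n = 1] the logarithmic factor may vanish, so no iteration may be spent. None is: the rows of
   the initial iterate are exact, and its single column sums to the total mass 1, which is [v]. *)
exists 0%N; have [/andP[r0 r1] /andP[e0 e1]] := (rhoP, epsP); split.
  have d0 : 0 <= gamma + gamma' - 1 by lra.
  rewrite n1 ln1 !mulr_ge0 ?invr_ge0 ?exprn_ge0 ?(ltW r0) //.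
  have := ln_le0 r1; have := ln_le0 e1; have : ln (gamma + gamma' - 1) <= 0.
    by apply: ln_le0; move: gammaP gamma'P; lra.
  lra.
have [x [y [[_ _ _ marg] _]]] := SK_scaling0 dk.
rewrite -/(marginal_error u v (SK B u v 0)) marginal_errorE -SKE.
rewrite big1 ?add0r => [|i _]; last by rewrite marg subrr normr0.
have -> : \sum_j `|v 0 j - \sum_i SK ((max_entry B)^-1 *: B) u v 0 i j| = 0; last exact: ltW.
subst n; rewrite big_ord1; apply/eqP; rewrite normr_eq0 subr_eq0; apply/eqP.
have := dk_v_sum dk; rewrite big_ord1 => ->; rewrite -(dk_u_sum dk).
by apply: eq_bigr => i _; rewrite -marg big_ord1.
Qed.
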